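(* Let $k\ge 3$ be a fixed integer. For a circle of radius $r>0$ let $\mathcal{A}$ be the area of the circle (i.e. of the disc it bounds), and for $n\ge 0$ let $P_n^L$ and $P_n^U$ be the perimeters of the regular $2^nk$-gons respectively inscribed in and circumscribed about the circle. Then $$\frac{\mathcal{A}}{r^2}=\operatorname{LUB}\left(\left\{\frac{P_n^L}{2r}\right\}_{n\ge0}\right)=\operatorname{GLB}\left(\left\{\frac{P_n^U}{2r}\right\}_{n\ge0}\right),$$ and this common value is a constant, independent of $r$.
   Context: LUB and GLB denote least upper bound and greatest lower bound. Start with a regular $k$-gon inscribed in the circle (stage $0$); the circumscribed polygon of the same stage is the regular polygon formed by the tangents to the circle at the vertices of the inscribed one. Each next stage doubles the number of sides: the midpoints of the arcs between adjacent vertices are added as new vertices of the inscribed polygon, and the tangents at these points are added. At stage $n$ both polygons are regular with $2^nk$ sides, with side lengths $L_n$ (inscribed) and $U_n$ (circumscribed), and perimeters $P_n^L=2^nkL_n$, $P_n^U=2^nkU_n$. *)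

(* Defs.v *)
From HB Require Import structures.
From mathcomp Require Import all_boot all_order all_algebra.
From mathcomp Require Import all_classical all_reals all_analysis.

Set Implicit Arguments.
Unset Strict Implicit.
Unset Printing Implicit Defensive.

Import Order.TTheory GRing.Theory Num.Theory.
Import numFieldNormedType.Exports.

Local Open Scope classical_set_scope.
Local Open Scope ring_scope.

(* The plane is [R * R].  The library norm on a product is the sup norm, so the
   Euclidean structure is defined here. *)
Definition dot (R : realType) (x y : R * R) : R := x.1 * y.1 + x.2 * y.2.

Definition cross (R : realType) (x y : R * R) : R := x.1 * y.2 - x.2 * y.1.

Definition enorm (R : realType) (x : R * R) : R := Num.sqrt (dot x x).

Definition edist (R : realType) (x y : R * R) : R := enorm (x - y).

Definition circle (R : realType) (c : R * R) (r : R) : set (R * R) :=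
  [set x | edist x c = r].

Definition disc (R : realType) (c : R * R) (r : R) : set (R * R) :=
  [set x | edist x c <= r].

Definition area (R : realType) (A : set (R * R)) : \bar R :=
  (@lebesgue_measure R \x @lebesgue_measure R)%E A.

(* Tangent at the point [p] to a circle of centre [c] through [p]. *)
Definition tangent (R : realType) (c p : R * R) : set (R * R) :=
  [set x | dot (x - p) (p - c) = 0].

(* Measure in [0, pi] of the angle x y z, with vertex [y]. *)
Definition angle (R : realType) (x y z : R * R) : R :=
  acos (dot (x - y) (z - y) / (edist x y * edist z y)).

(* An m-gon is given by its vertices [v : 'I_m -> R * R] listed in cyclic
   order; [ordS] and [ord_pred] are the cyclic successor and predecessor. *)
Definition perimeter (R : realType) (m : nat) (v : 'I_m -> R * R) : R :=
  \sum_(i < m) edist (v i) (v (ordS i)).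

(* For every side, the vertices that are not endpoints of that side all lie
   strictly on the same side of its supporting line (the two indices [j] and [l]
   may coincide).  Either orientation is allowed.  For m >= 3 this makes the
   vertices pairwise distinct and rules out star polygons. *)
Definition convex_polygon (R : realType) (m : nat) (v : 'I_m -> R * R) : Prop :=
  forall i j l : 'I_m,
    j != i -> j != ordS i -> l != i -> l != ordS i ->
    0 < cross (v (ordS i) - v i) (v j - v i) *
        cross (v (ordS i) - v i) (v l - v i).

Definition equilateral (R : realType) (m : nat) (v : 'I_m -> R * R) : Prop :=
  forall i j : 'I_m, edist (v i) (v (ordS i)) = edist (v j) (v (ordS j)).

Definition equiangular (R : realType) (m : nat) (v : 'I_m -> R * R) : Prop :=
  forall i j : 'I_m, angle (v (ord_pred i)) (v i) (v (ordS i)) =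
                     angle (v (ord_pred j)) (v j) (v (ordS j)).

Definition regular_polygon (R : realType) (m : nat) (v : 'I_m -> R * R) : Prop :=
  [/\ convex_polygon v, equilateral v & equiangular v].

Definition inscribed (R : realType) (m : nat) (c : R * R) (r : R)
    (v : 'I_m -> R * R) : Prop :=
  forall i : 'I_m, circle c r (v i).

(* [w] is the polygon cut out by the tangents at the vertices of the inscribed
   polygon [v]: its vertex [w i] is where the tangents at the adjacent vertices
   [v i] and [v (ordS i)] meet. *)
Definition circumscribed (R : realType) (m : nat) (c : R * R)
    (v w : 'I_m -> R * R) : Prop :=
  forall i : 'I_m, (tangent c (v i) `&` tangent c (v (ordS i))) (w i).

(* Main.v *)
Require Import Defs.
From HB Require Import structures.
From mathcomp Require Import all_boot all_order all_algebra.
From mathcomp Require Import all_classical all_reals all_analysis.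
From mathcomp Require Import ring lra zify.

Import Order.TTheory GRing.Theory Num.Theory.
Import numFieldNormedType.Exports.

Local Open Scope classical_set_scope.
Local Open Scope ring_scope.

(* The constant is [pi].  The area is a Fubini integral of the vertical chords,
   computed with the substitution x = a + r sin t.  For an inscribed polygon
   with equal sides, convexity forces all the rotations taking a vertex to the
   next one (seen from the centre) to be the same rotation, of some angle 2b in
   ]-pi, pi[; comparing the orientations of the triangles (v_0, v_1, v_j) then
   shows that sin (j b) keeps a constant sign for 0 < j < m, so that the polygon
   winds only once and |b| = pi / m.  The sides are therefore 2 r sin (pi / m) and
   2 r tan (pi / m), and x cos x <= sin x <= x concludes. *)

(** * Area of the disc *)

Lemma differentiable_oo_LRcontinuous (R : realType) (F f : R -> R) (a b : R) :
  (forall x : R, is_derive x 1 F (f x)) -> derivable_oo_LRcontinuous F a b.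
Proof.
move=> dF.
have cF : continuous F.
  by move=> x; apply/differentiable_continuous/derivable1_diffP; have [] := dF x.
split; first by move=> x _; have [] := dF x.
- exact/cvg_at_right_filter/cF.
- exact/cvg_at_left_filter/cF.
Qed.

Lemma integral_vertical_chord (R : realType) (a r : R) : 0 < r ->
  (\int[@lebesgue_measure R]_(x in `[(a - r)%R, (a + r)%R])
     (2 * Num.sqrt (r ^+ 2 - (x - a) ^+ 2))%:E = (pi * r ^+ 2)%:E)%E.
Proof.
move=> r0.
pose G (x : R) : R := 2 * Num.sqrt (r ^+ 2 - (x - a) ^+ 2).
pose F (t : R) : R := a + r * sin t.
have dF (t : R) : is_derive t 1 F (r * cos t).
  by rewrite /F; apply: is_derive_eq; rewrite add0r mul1r.
have F'E : derive1 F = (fun t => r * cos t).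
  by apply/funext => t; rewrite derive1E derive_val.
have cF' : continuous (derive1 F).
  by rewrite F'E => t; apply: continuousM; [exact: cst_continuous|exact: continuous_cos].
have pi0 := pi_gt0 R.
have FL : F (- (pi / 2)) = a - r by rewrite /F sinN sin_pihalf mulrN mulr1.
have FR : F (pi / 2) = a + r by rewrite /F sin_pihalf mulr1.
rewrite -FL -FR (@integration_by_substitution_increasing _ F G); last first.
- apply: continuous_subspaceT; rewrite /G => x.
  apply: (@continuousM _ _ (fun=> 2) (fun x : R => Num.sqrt (r ^+ 2 - (x - a) ^+ 2))).
    exact: cst_continuous.
  apply: continuous_comp; last exact: sqrt_continuous.
  apply: continuousB; first exact: cst_continuous.
  apply: (@continuous_comp _ _ _ (fun y : R => y - a) (fun y : R => y ^+ 2)).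
    by apply: continuousB => //; exact: cst_continuous.
  exact: exprn_continuous.
- exact: differentiable_oo_LRcontinuous dF.
- by apply/cvg_ex; exists (derive1 F (pi / 2)); exact/cvg_at_left_filter/cF'.
- by apply/cvg_ex; exists (derive1 F (- (pi / 2))); exact/cvg_at_right_filter/cF'.
- by move=> t _; exact: cF'.
- by move=> x y xI yI xy; rewrite /F ltrD2l ltr_pM2l// ltr_sin.
- lra.
(* An antiderivative of the substituted integrand: [t + sin t * cos t] has derivative
   [1 + cos t ^+ 2 - sin t ^+ 2], which is [2 * cos t ^+ 2]. *)
pose H (t : R) : R := r ^+ 2 * (t + sin t * cos t).
have dH (t : R) : is_derive t 1 H (2 * r ^+ 2 * cos t ^+ 2).
  rewrite /H; apply: is_derive_eq; rewrite /GRing.scale /=.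
  by rewrite -[X in _ * (X + _)](cos2Dsin2 t); ring.
transitivity (\int[@lebesgue_measure R]_(t in `[(- (pi / 2))%R, (pi / 2)%R])
     (2 * r ^+ 2 * cos t ^+ 2)%:E)%E.
  apply: eq_integral => t; rewrite inE /= in_itv /= => tI.
  rewrite F'E; congr EFin.
  transitivity (2 * Num.sqrt (r ^+ 2 - (a + r * sin t - a) ^+ 2) * (r * cos t)) => //.
  have -> : r ^+ 2 - (a + r * sin t - a) ^+ 2 = (r * cos t) ^+ 2.
    by rewrite [in RHS]exprMn cos2sin2; ring.
  (* The square root is [|r cos t|]; the absolute value drops because the cosine is nonnegative
     between [- (pi / 2)] and [pi / 2]. *)
  by rewrite sqrtr_sqr ger0_norm ?mulr_ge0 ?cos_ge0_pihalf ?(ltW r0)//; ring.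
rewrite (@continuous_FTC2 _ _ H).
- rewrite -EFinD /H cosN cos_pihalf !mulr0 !addr0; congr EFin; field; lra.
- lra.
- apply: (@continuous_subspaceT _ _ _ (fun x : R => 2 * r ^+ 2 * cos x ^+ 2)) => x.
  apply: (@continuousM _ _ (fun=> 2 * r ^+ 2) (fun x : R => cos x ^+ 2)).
    exact: cst_continuous.
  apply: (@continuous_comp _ _ _ cos (fun y : R => y ^+ 2)).
    exact: continuous_cos.
  exact: exprn_continuous.
- exact: differentiable_oo_LRcontinuous dH.
- by move=> t _; rewrite derive1E derive_val.
Qed.

Lemma mem_disc (R : realType) (c p : R * R) (r : R) : 0 <= r ->
  disc c r p <-> (p.1 - c.1) ^+ 2 + (p.2 - c.2) ^+ 2 <= r ^+ 2.
Proof.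
move=> r0; rewrite !expr2 -/(dot (p - c) (p - c)) -expr2.
by rewrite -ler_sqrt ?sqr_ge0// sqrtr_sqr ger0_norm.
Qed.

Lemma area_disc (R : realType) (c : R * R) (r : R) : 0 < r ->
  area (disc c r) = (pi * r ^+ 2)%:E.
Proof.
move=> r0; have r0' := ltW r0.
(* The product measure unfolds to the integral over the whole line of the measures of vertical
   sections, so the chord length is extended by zero and compared pointwise. *)
rewrite -(integral_vertical_chord R c.1 _ r0) integral_mkcond.
apply: eq_integral => /= x _; rewrite patchE.
set s : R := Num.sqrt _.
have s0 : 0 <= s by exact: sqrtr_ge0.
have [xI|xI] := boolP (`|x - c.1| <= r).
  have le2 : (x - c.1) ^+ 2 <= r ^+ 2.
    by rewrite -(real_normK (num_real (x - c.1))) ler_pXn2r ?nnegrE.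
  have s2 : s ^+ 2 = r ^+ 2 - (x - c.1) ^+ 2 by rewrite sqr_sqrtr// subr_ge0.
  rewrite mem_set /= ?in_itv /= -?ler_distl//.
  have -> : xsection (disc c r) x = `[(c.2 - s)%R, (c.2 + s)%R]%classic.
    apply/seteqP; split=> y; rewrite /xsection /= inE mem_disc// in_itv /=.
      move=> yI; rewrite -ler_distl -(@ler_pXn2r _ 2) ?nnegrE//.
      by rewrite real_normK ?num_real// s2; lra.
    rewrite -ler_distl -(@ler_pXn2r _ 2) ?nnegrE//.
    by rewrite real_normK ?num_real// s2; lra.
  rewrite lebesgue_measure_itv /= lte_fin.
  (* The measure of an interval is given by cases on whether its endpoints are strictly ordered; in
     the other case the chord is a single point, [s = 0], and both sides vanish. *)
  case: ifPn => [_|]; first by rewrite -EFinB; congr EFin; ring.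
  by rewrite -leNgt => ?; congr EFin; lra.
rewrite memNset /= ?in_itv /= -?ler_distl; last exact/negP.
suff -> : xsection (disc c r) x = set0 by rewrite measure0.
apply/seteqP; split=> y //; rewrite /xsection /= inE mem_disc// => /= yI.
have := sqr_ge0 (y - c.2) => ?; move/negP: xI; apply.
by rewrite -(@ler_pXn2r _ 2) ?nnegrE// real_normK ?num_real//; lra.
Qed.

(** * Cyclic indices *)

Lemma val_iter_ordS (m : nat) (i : 'I_m) (j : nat) :
  iter j (@ordS m) i = ((i + j) %% m)%N :> nat.
Proof.
elim: j => [|j IH] /=; first by rewrite addn0 modn_small.
by rewrite IH -addn1 modnDml addn1 addnS.
Qed.

Lemma iter_ordS_neq (m : nat) (i : 'I_m) (j l : nat) :
  (j < m)%N -> (l < m)%N -> j != l ->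
  iter j (@ordS m) i != iter l (@ordS m) i.
Proof.
move=> jm lm; apply: contraNneq => /(congr1 (@nat_of_ord m)).
by rewrite !val_iter_ordS => /eqP; rewrite eqn_modDl !modn_small.
Qed.

(** This supplies the side conditions of [convex_polygon] for the side that starts at [i]. *)
Lemma iter_ordS_neq_side (m : nat) (i : 'I_m) (j : nat) : (1 < j < m)%N ->
  (iter j (@ordS m) i != i) * (iter j (@ordS m) i != ordS i).
Proof.
move=> /andP[j1 jm]; split.
  by apply: (@iter_ordS_neq _ i j 0) => //; lia.
by apply: (@iter_ordS_neq _ i j 1) => //; lia.
Qed.

Lemma iter_ordS_id (m : nat) (i : 'I_m) : iter m (@ordS m) i = i.
Proof. by apply: ord_inj; rewrite val_iter_ordS modnDr modn_small. Qed.

(** * Vector and half-angle identities *)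

Lemma edist_sqr (R : realType) (x y : R * R) :
  Defs.edist x y ^+ 2 = dot (x - y) (x - y).
Proof. by rewrite sqr_sqrtr// /dot -!expr2 addr_ge0 ?sqr_ge0. Qed.

Lemma dot_cross (R : realType) (x y : R * R) :
  dot x y ^+ 2 + cross x y ^+ 2 = dot x x * dot y y.
Proof. by rewrite /dot /cross; ring. Qed.

(** In the complex plane [dot a x] and [cross a x] are the real and imaginary parts of conj(a) x.
    This is the real part of |x|^2 conj(a) y = (conj(a) x)(conj(x) y), and [cross_rotate] is the
    imaginary part: together they compose the turn from [a] to [x] with the turn from [x] to [y]. *)
Lemma dot_rotate (R : realType) (a x y : R * R) :
  dot x x * dot a y = dot x y * dot a x - cross x y * cross a x.
Proof. by rewrite /dot /cross; ring. Qed.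

Lemma cross_rotate (R : realType) (a x y : R * R) :
  dot x x * cross a y = dot x y * cross a x + cross x y * dot a x.
Proof. by rewrite /dot /cross; ring. Qed.

Lemma edist_sqr_center (R : realType) (c x y : R * R) :
  Defs.edist x y ^+ 2 =
  dot (x - c) (x - c) + dot (y - c) (y - c) - 2 * dot (x - c) (y - c).
Proof. by rewrite edist_sqr /dot /=; ring. Qed.

Lemma cross_subl_subl (R : realType) (c x y z : R * R) :
  cross (y - x) (z - x) =
  cross (y - c) (z - c) + cross (x - c) (y - c) - cross (x - c) (z - c).
Proof. by rewrite /cross /=; ring. Qed.

Lemma cos_double (R : realType) (x : R) : cos (2 * x) = 1 - 2 * sin x ^+ 2.
Proof. by rewrite mulr_natl cos_mulr2n cos2sin2; ring. Qed.

Lemma sin_double (R : realType) (x : R) : sin (2 * x) = 2 * sin x * cos x.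
Proof. by rewrite mulr_natl sin_mulr2n; ring. Qed.

(** The left side is twice the signed area of the triangle on the unit circle with vertices at
    angles 0, [2 * b] and [2 * (a + b)]; the product form makes its orientation readable. *)
Lemma sinD_sub_double (R : realType) (a b : R) :
  sin (2 * a) + sin (2 * b) - sin (2 * (a + b)) =
  4 * sin b * (sin a * sin (a + b)).
Proof.
rewrite !sin_double cosD sinD.
have := cos2Dsin2 a; have := cos2Dsin2 b.
set x := cos a; set y := sin a; set z := cos b; set t := sin b => zt xy.
transitivity (2 * x * y * (1 - z ^+ 2 + t ^+ 2) + 2 * z * t * (1 - x ^+ 2 + y ^+ 2)).
  by ring.
have -> : 1 - z ^+ 2 = t ^+ 2 by lra.
have -> : 1 - x ^+ 2 = y ^+ 2 by lra.
by ring.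
Qed.

(** By induction the multiples [j * b] with [0 < j < m] stay below [pi]: the first one to reach [pi]
    would lie less than [b] beyond it and have a nonpositive sine, while its predecessor has a
    positive one. Hence [m * b] lies strictly between 0 and [pi + b], where the sine vanishes only
    at [pi]. *)
Lemma sin_multiples_eq_pi (R : realType) (m : nat) (b : R) :
  (3 <= m)%N -> 0 < b < pi / 2 ->
  (forall j : nat, (2 <= j < m)%N -> 0 < sin (j.-1%:R * b) * sin (j%:R * b)) ->
  sin (m%:R * b) = 0 -> b = pi / m%:R.
Proof.
move=> m3 /andP[b0 bpi] pos sinm.
have pi0 := pi_gt0 R.
have lt_pi j : (0 < j < m)%N -> j%:R * b < pi.
  elim: j => // j IH /andP[_ jm].
  have [->|j0] := posnP j; first by lra.
  have {}IH : j%:R * b < pi by apply: IH; rewrite j0 ltnW.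
  have jb0 : 0 < j%:R * b by rewrite mulr_gt0 ?ltr0n.
  have sj : 0 < sin (j%:R * b) by rewrite sin_gt0_pi// jb0.
  have := pos j.+1; rewrite ltnS j0 jm => /(_ isT) /=; rewrite pmulr_rgt0// => sj1.
  rewrite ltNge; apply/negP => le_pi.
  have : 0 <= sin (j.+1%:R * b - pi).
    by apply: sin_ge0_pi; rewrite -natr1; apply/andP; split; lra.
  by rewrite sinB cospi sinpi; lra.
have bm : m.-1%:R * b < pi by apply: lt_pi; lia.
have mE : m%:R * b = m.-1%:R * b + b.
  by rewrite -[in LHS](@prednK m) -1?natr1 ?mulrDl ?mul1r//; lia.
have m0 : 0 < m%:R :> R by rewrite ltr0n; lia.
suff : m%:R * b = pi by move=> <-; field; lra.
have mb0 : 0 < m%:R * b by rewrite mulr_gt0.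
have [lt|gt|//] := ltgtP (m%:R * b) pi.
  have : 0 < sin (m%:R * b) by rewrite sin_gt0_pi// mb0.
  lra.
have : 0 < sin (m%:R * b - pi) by rewrite sin_gt0_pi//; apply/andP; split; lra.
by rewrite sinB sinm sinpi; lra.
Qed.

Lemma pi_div_itv (R : realType) (m : nat) : (3 <= m)%N ->
  0 < (pi : R) / m%:R < pi / 2.
Proof.
move=> m3; have m0 : 0 < m%:R :> R by rewrite ltr0n; lia.
by rewrite divr_gt0 ?pi_gt0//= ltr_pM2l ?pi_gt0// ltf_pV2 ?posrE// ltr_nat.
Qed.

Lemma sin_pi_div_gt0 (R : realType) (m : nat) : (3 <= m)%N -> 0 < sin ((pi : R) / m%:R).
Proof. by move=> m3; rewrite sin_gt0_pihalf// pi_div_itv. Qed.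

Lemma cos_pi_div_gt0 (R : realType) (m : nat) : (3 <= m)%N -> 0 < cos ((pi : R) / m%:R).
Proof.
move=> /(pi_div_itv R)/andP[b0 bpi].
by rewrite cos_gt0_pihalf//; apply/andP; split; lra.
Qed.

(** * Side lengths of the two polygons *)

Section inscribed_regular_polygon.
Variables (R : realType) (m : nat) (c : R * R) (r : R) (v : 'I_m -> R * R).
Hypotheses (m3 : (3 <= m)%N) (r0 : 0 < r).
Hypotheses (vreg : regular_polygon v) (vc : inscribed c r v).

Lemma inscribed_dot (i : 'I_m) : dot (v i - c) (v i - c) = r ^+ 2.
Proof. by rewrite -edist_sqr vc. Qed.

Lemma regular_dot_succ (i j : 'I_m) :
  dot (v i - c) (v (ordS i) - c) = dot (v j - c) (v (ordS j) - c).
Proof.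
have [_ /(_ i j) /(congr1 (fun x => x ^+ 2)) + _] := vreg.
by rewrite !(edist_sqr_center _ c) !inscribed_dot; lra.
Qed.

(** Convexity with both test vertices equal to the second successor makes a square positive, which a
    return to [v i] would annul. *)
Lemma convex_succ2_neq (i : 'I_m) : v (ordS (ordS i)) <> v i.
Proof.
move=> vi; have [/(_ i (ordS (ordS i)) (ordS (ordS i))) + _ _] := vreg.
rewrite vi /cross /= !(subrr, mulr0) ltxx => H.
by have [n0 n1] := iter_ordS_neq_side _ i 2 m3; have := H n0 n1 n0 n1.
Qed.

(* Equal sides make consecutive turns equal up to sign; a turn followed by its
   opposite, or a null turn, would bring the polygon back to [v i]. *)
Lemma regular_turn (i : 'I_m) :
  cross (v i - c) (v (ordS i) - c) != 0 /\
  cross (v (ordS i) - c) (v (ordS (ordS i)) - c) =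
  cross (v i - c) (v (ordS i) - c).
Proof.
set X := cross _ _; set Y := cross _ _.
have D := regular_dot_succ (ordS i) i.
have dX := dot_cross _ (v i - c) (v (ordS i) - c).
have dY := dot_cross _ (v (ordS i) - c) (v (ordS (ordS i)) - c).
have dZ := dot_rotate _ (v i - c) (v (ordS i) - c) (v (ordS (ordS i)) - c).
rewrite !inscribed_dot -/X -/Y D in dX dY dZ.
(* Given [X ^+ 2 = Y ^+ 2], this excludes the null turn as well, since [X = 0] would give
   [Y = 0 = - X]. *)
have NXY : Y != - X.
  apply/eqP => YX; apply: (@convex_succ2_neq i).
  have dr : dot (v i - c) (v (ordS (ordS i)) - c) = r ^+ 2.
    apply: (@mulfI _ (r ^+ 2)); first by rewrite expf_neq0// gt_eqF.
    by rewrite dZ YX -dX; ring.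
  have : Defs.edist (v (ordS (ordS i))) (v i) ^+ 2 = 0.
    rewrite (edist_sqr_center _ c) !inscribed_dot.
    have -> : dot (v (ordS (ordS i)) - c) (v i - c) = r ^+ 2.
      by rewrite -dr /dot; ring.
    by ring.
  rewrite edist_sqr /dot -!expr2 => /eqP.
  rewrite paddr_eq0 ?sqr_ge0// !sqrf_eq0 !subr_eq0 => /andP[/eqP e1 /eqP e2].
  by case: (v (ordS (ordS i))) e1 e2 => ? ?; case: (v i) => ? ? /= -> ->.
have XY : X ^+ 2 = Y ^+ 2 by lra.
move/eqP: XY; rewrite eq_sym eqf_sqr (negPf NXY) orbF => /eqP YX; split => //.
by apply: contraNneq NXY => X0; rewrite YX X0 oppr0.
Qed.

Lemma regular_cross_iter (i : 'I_m) (j : nat) :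
  cross (v (iter j (@ordS m) i) - c) (v (iter j.+1 (@ordS m) i) - c) =
  cross (v i - c) (v (ordS i) - c).
Proof. by elim: j => //= j <-; have [_] := regular_turn (iter j (@ordS m) i). Qed.

(** The sign [e] records the orientation, so that one angle [a] serves clockwise and
    counterclockwise polygons alike. Each step composes one more turn; [e] enters the cosine only
    through its square. *)
Lemma regular_rotation (i : 'I_m) (e a : R) (j : nat) : e ^+ 2 = 1 ->
  dot (v i - c) (v (ordS i) - c) = r ^+ 2 * cos a ->
  cross (v i - c) (v (ordS i) - c) = r ^+ 2 * (e * sin a) ->
  dot (v i - c) (v (iter j (@ordS m) i) - c) = r ^+ 2 * cos (j%:R * a) /\
  cross (v i - c) (v (iter j (@ordS m) i) - c) = r ^+ 2 * (e * sin (j%:R * a)).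
Proof.
move=> e1 di xi; elim: j => [|j [IHd IHx]].
  rewrite mul0r cos0 sin0 /= inscribed_dot; split; first by ring.
  by rewrite /cross; ring.
set u := iter j _ i in IHd IHx *.
have xj : cross (v u - c) (v (ordS u) - c) = r ^+ 2 * (e * sin a).
  by rewrite -xi -(regular_cross_iter i j).
have dj := regular_dot_succ u i; rewrite di in dj.
have r2 : r ^+ 2 != 0 by rewrite expf_neq0// gt_eqF.
rewrite -natr1 mulrDl mul1r cosD sinD /= -/u; split; apply: (mulfI r2).
  rewrite -[X in X * dot _ _](inscribed_dot u) dot_rotate dj xj IHd IHx.
  transitivity (r ^+ 2 * (r ^+ 2 * (cos (j%:R * a) * cos a -
    e ^+ 2 * (sin (j%:R * a) * sin a)))); first by ring.
  by rewrite e1 mul1r.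
rewrite -[X in X * cross _ _](inscribed_dot u) cross_rotate dj xj IHd IHx.
by ring.
Qed.

Lemma regular_inscribed_dot (i : 'I_m) :
  dot (v i - c) (v (ordS i) - c) = r ^+ 2 * cos (2 * (pi / m%:R)).
Proof.
have r2 : r ^+ 2 != 0 by rewrite expf_neq0// gt_eqF.
(* [C] and [S] are the cosine and the signed sine of the central angle of a side. *)
pose C := dot (v i - c) (v (ordS i) - c) / r ^+ 2.
pose S := cross (v i - c) (v (ordS i) - c) / r ^+ 2.
have dE : dot (v i - c) (v (ordS i) - c) = r ^+ 2 * C by rewrite mulrC divfK.
have xE : cross (v i - c) (v (ordS i) - c) = r ^+ 2 * S by rewrite mulrC divfK.
have [X0 _] := regular_turn i.
have S0 : S != 0 by apply: contraNneq X0 => S0; rewrite xE S0 mulr0.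
have CS : C ^+ 2 + S ^+ 2 = 1.
  have := dot_cross _ (v i - c) (v (ordS i) - c).
  rewrite !inscribed_dot dE xE => H.
  apply: (@mulfI _ ((r ^+ 2) ^+ 2)); first by rewrite expf_neq0.
  by rewrite mulr1 [RHS]expr2 -H; ring.
have S2 : 0 < S ^+ 2 by rewrite exprn_even_gt0.
have CI : -1 < C < 1 by apply/andP; split; nra.
have CI' : -1 <= C <= 1 by lra.
(* Half the unsigned central angle. Since [S] is nonzero, [C] avoids 1 and -1, which puts [b]
   strictly between 0 and [pi / 2]; the sign of [S] goes into [e]. *)
pose b := acos C / 2.
have Cb : C = cos (2 * b) by rewrite mulrC divfK ?acosK ?in_itv//= ?pnatr_eq0.
have b0 : 0 < b by rewrite divr_gt0// acos_gt0//; lra.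
have bpi : b < pi / 2 by rewrite ltr_pM2r ?invr_gt0// acos_ltpi//; lra.
pose e := Num.sg S.
have e1 : e ^+ 2 = 1 by rewrite sqr_sg S0.
have Sb : S = e * sin (2 * b).
  rewrite /b [2 * _]mulrC divfK ?pnatr_eq0// sin_acos//.
  have -> : 1 - C ^+ 2 = S ^+ 2 by lra.
  by rewrite sqrtr_sqr -numEsg.
have rot j := regular_rotation i e (2 * b) j e1.
have rot' j := regular_rotation (ordS i) e (2 * b) j e1.
suff <- : b = pi / m%:R by rewrite -Cb.
have sb : 0 < sin b by rewrite sin_gt0_pihalf// b0.
apply: sin_multiples_eq_pi => //; first by rewrite b0.
(* The triangle is split into triangles with apex [c], whose signed areas are sines of multiples of
   [2 * b]; then [sinD_sub_double] applies with [a] equal to [j * b]. *)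
- have key j : cross (v (ordS i) - v i) (v (iter j.+1 (@ordS m) i) - v i) =
      r ^+ 2 * (e * (4 * sin b * (sin (j%:R * b) * sin (j.+1%:R * b)))).
    rewrite (cross_subl_subl _ c) xE Sb.
    have [||_ ->] := rot j.+1; rewrite -?Cb -?Sb//.
    have [_ X'] := regular_turn i.
    have := rot' j; rewrite (regular_dot_succ _ i) X' -Cb -Sb dE xE.
    move=> /(_ erefl erefl)[_]; rewrite -iterSr => ->.
    have := sinD_sub_double _ (j%:R * b) b.
    have -> : j%:R * b + b = j.+1%:R * b by rewrite -natr1; ring.
    rewrite !(mulrCA _ 2) => id4.
    transitivity (r ^+ 2 * (e * (sin (2 * (j%:R * b)) + sin (2 * b) -
      sin (2 * (j.+1%:R * b))))); last by rewrite id4.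
    by rewrite Sb; ring.
  have [cvx _ _] := vreg.
  case=> [//|j] /andP[j2 jm] /=.
  (* The vertex two steps after [i] is the reference: its orientation has the sign of
     [e * (sin b * sin (2 * b))], hence of [e], and convexity passes this sign to all later
     vertices. *)
  have := cvx i (iter j.+1 (@ordS m) i) (iter 2 (@ordS m) i).
  have [-> ->] := iter_ordS_neq_side _ i 2 m3.
  have [|-> ->] := iter_ordS_neq_side _ i j.+1; first by rewrite j2.
  move=> /(_ isT isT isT isT); rewrite !key mul1r.
  have s2b : 0 < sin (2 * b) by rewrite sin_gt0_pi//; apply/andP; split; lra.
  set p := sin (j%:R * b) * _.
  have -> : r ^+ 2 * (e * (4 * sin b * p)) *
      (r ^+ 2 * (e * (4 * sin b * (sin b * sin (2 * b))))) =
      16 * r ^+ 4 * e ^+ 2 * sin b ^+ 3 * sin (2 * b) * p by ring.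
  by rewrite e1 pmulr_rgt0// !mulr_gt0// exprn_gt0.
(* After [m] turns the polygon closes up, so [cos (2 * (m * b)) = 1]. *)
- have := rot m; rewrite dE xE -Cb -Sb => /(_ erefl erefl)[+ _].
  rewrite iter_ordS_id inscribed_dot mulrCA cos_double => H.
  have : 1 = 1 - 2 * sin (m%:R * b) ^+ 2 by apply: (mulfI r2); rewrite -H mulr1.
  by move=> ?; apply/eqP; rewrite -sqrf_eq0; apply/eqP; lra.
Qed.

Lemma regular_inscribed_side (i : 'I_m) :
  Defs.edist (v i) (v (ordS i)) = 2 * r * sin (pi / m%:R).
Proof.
have s0 := ltW (sin_pi_div_gt0 R m m3).
apply: (@pexpIrn _ 2) => //; rewrite ?nnegrE ?sqrtr_ge0 ?mulr_ge0 ?(ltW r0)//.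
rewrite (edist_sqr_center _ c) !inscribed_dot regular_inscribed_dot cos_double.
by ring.
Qed.

(** Both ends of the side lie on the tangent at [x], the radius vector of [v (ordS i)], so the side
    is orthogonal to [x] and its length times [r] is [|A - B|]. The tangents at the two neighbouring
    vertices determine [A] and [B]. *)
Lemma circumscribed_side (w : 'I_m -> R * R) (i : 'I_m) : circumscribed c v w ->
  Defs.edist (w i) (w (ordS i)) = 2 * r * tan (pi / m%:R).
Proof.
move=> wc.
have c0 := cos_pi_div_gt0 R m m3.
have s0 := sin_pi_div_gt0 R m m3.
set b := pi / m%:R in c0 s0 *.
have dE j : dot (v j - c) (v (ordS j) - c) = r ^+ 2 * cos (2 * b).
  exact: regular_inscribed_dot.
have tanE p j : tangent c (v j) p -> dot (p - c) (v j - c) = r ^+ 2.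
  rewrite -(inscribed_dot j) -[RHS]add0r => <-.
  by rewrite /dot /=; ring.
have [_ /tanE d1] := wc i.
have [/tanE d2 _] := wc (ordS i).
have [/tanE d0 _] := wc i.
have [_ /tanE d3] := wc (ordS i).
have [_ X1] := regular_turn i.
set x := v (ordS i) - c in d1 d2 X1.
have xx : dot x x = r ^+ 2 := inscribed_dot (ordS i).
have yx : dot x (v i - c) = r ^+ 2 * cos (2 * b) by rewrite -(dE i) /x /dot; ring.
pose X := cross (v i - c) x.
have Xyx : cross x (v i - c) = - X by rewrite /X /cross; ring.
pose A := cross (w i - c) x.
pose B := cross (w (ordS i) - c) x.
have rA := dot_rotate _ (w i - c) x (v i - c).
have rB := dot_rotate _ (w (ordS i) - c) x (v (ordS (ordS i)) - c).
have X2 := dot_cross _ (v i - c) x.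
have dist := dot_cross _ (w i - w (ordS i)) x.
rewrite xx d0 yx Xyx d1 -/A in rA.
rewrite xx d3 dE d2 X1 -/B in rB.
rewrite xx inscribed_dot dE -/X in X2.
have wx0 : dot (w i - w (ordS i)) x = 0.
  transitivity (dot (w i - c) x - dot (w (ordS i) - c) x).
    by rewrite /dot /=; ring.
  by rewrite d1 d2 subrr.
have wxAB : cross (w i - w (ordS i)) x = A - B by rewrite /A /B /cross /=; ring.
rewrite wx0 wxAB xx -edist_sqr in dist.
apply: (@pexpIrn _ 2) => //; rewrite ?nnegrE ?sqrtr_ge0//.
  by rewrite /tan !mulr_ge0 ?invr_ge0 ?(ltW r0) ?(ltW s0) ?(ltW c0).
set d := Defs.edist _ _ in dist *.
(* Only the products of [A] and [B] with [X] are known, as the orientation is unspecified; squaring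
   then removes the sign of [X]. *)
have XAB : X * (A - B) = 4 * r ^+ 4 * sin b ^+ 2.
  transitivity (2 * r ^+ 4 * (1 - cos (2 * b))); last by rewrite cos_double; ring.
  rewrite -/X in rB; lra.
have X2' : X ^+ 2 = 4 * r ^+ 4 * sin b ^+ 2 * cos b ^+ 2.
  transitivity (r ^+ 4 * (1 - cos (2 * b) ^+ 2)); first by lra.
  by rewrite -sin2cos2 sin_double; ring.
have key : d ^+ 2 * cos b ^+ 2 = 4 * r ^+ 2 * sin b ^+ 2.
  (* The multiplier is [X ^+ 2 * r ^+ 2 / cos b ^+ 2]. *)
  apply: (@mulfI _ (4 * r ^+ 6 * sin b ^+ 2)).
    by rewrite !mulf_neq0 ?expf_neq0 ?pnatr_eq0 ?gt_eqF.
  transitivity (X ^+ 2 * (d ^+ 2 * r ^+ 2)); first by rewrite X2'; ring.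
  rewrite -dist expr0n add0r -exprMn XAB; ring.
rewrite /tan.
transitivity (d ^+ 2 * cos b ^+ 2 / cos b ^+ 2); first by field; lra.
by rewrite key; field; lra.
Qed.

End inscribed_regular_polygon.

(** * Bounds and limits for the perimeters *)

Lemma sin_bounds (R : realType) (x : R) : 0 <= x <= pi ->
  x * cos x <= sin x <= x.
Proof.
move=> /andP[x0 xpi].
have [|z] := @MVT_segment R sin cos 0 x x0.
- by apply: continuous_subspaceT => y; exact: continuous_sin.
rewrite in_itv /= => /andP[z0 zx]; rewrite sin0 !subr0 => ->.
rewrite mulrC ler_wpM2r//=; last first.
  by rewrite leNgt ltr_cos ?in_itv /= -?leNgt ?x0 ?z0 ?(le_trans zx).
by rewrite ler_piMl// cos_le1.
Qed.

(** An upper bound that is also the limit lies below every other upper bound, because limits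
    preserve weak inequalities. *)
Lemma supremums_cvg (R : realType) (u : nat -> R) (l : R) :
  (forall n, u n <= l) -> u n @[n --> \oo] --> l ->
  supremums [set u n | n in [set: nat]] l.
Proof.
move=> ul cu; split; first by move=> _ [n _ <-].
move=> M uM; rewrite -(cvg_lim _ cu)//; apply: limr_le; first exact/cvgP/cu.
by apply: nearW => n; apply: uM; exists n.
Qed.

Lemma infimums_cvg (R : realType) (u : nat -> R) (l : R) :
  (forall n, l <= u n) -> u n @[n --> \oo] --> l ->
  infimums [set u n | n in [set: nat]] l.
Proof.
move=> ul cu; split; first by move=> _ [n _ <-].
move=> M uM; rewrite -(cvg_lim _ cu)//; apply: limr_ge; first exact/cvgP/cu.
by apply: nearW => n; apply: uM; exists n.
Qed.

Lemma cvg_cos_pi_div (R : realType) (k : nat) : (0 < k)%N ->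
  cos (pi / (2 ^ n * k)%:R) @[n --> \oo] --> (1 : R).
Proof.
move=> k0; rewrite -[X in _ --> X](@cos0 R).
suff lim0 : (pi : R) / (2 ^ n * k)%:R @[n --> \oo] --> (0 : R).
  exact: (continuous_cvg _ (@continuous_cos R 0) lim0).
(* Doubling the number of sides halves the angle: a geometric sequence. *)
have geo n : (pi : R) / (2 ^ n * k)%:R = pi / k%:R * 2^-1 ^+ n.
  by rewrite natrM natrX invfM -exprVn [_ ^+ n * _]mulrC mulrA.
have lim : (pi : R) / k%:R * 2^-1 ^+ n @[n --> \oo] --> pi / k%:R * 0.
  apply: cvgM; first exact: cvg_cst.
  by apply: cvg_expr; rewrite ger0_norm ?invr_ge0// invf_lt1 ?ltr1n.
by rewrite mulr0 in lim; rewrite (eq_cvg _ _ geo).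
Qed.

(** This is [sin_bounds] at [pi / m], multiplied by [m]. Both ends tend to [pi], and dividing by the
    cosine yields the bounds for the tangent. *)
Lemma mul_sin_pi_div_bounds (R : realType) (m : nat) : (3 <= m)%N ->
  pi * cos (pi / m%:R) <= m%:R * sin ((pi : R) / m%:R) <= pi.
Proof.
move=> m3; have m0 : 0 < m%:R :> R by rewrite ltr0n; lia.
have /andP[b0 bpi] := pi_div_itv R m m3.
have bI : 0 <= (pi : R) / m%:R <= pi.
  by have pi0 := pi_gt0 R; apply/andP; split; lra.
have /andP[lo hi] := sin_bounds R _ bI.
rewrite [m%:R * _]mulrC; apply/andP; split; last by rewrite -ler_pdivlMr.
by rewrite -ler_pdivrMr// mulrAC.
Qed.

Lemma mul_tan_pi_div_bounds (R : realType) (m : nat) : (3 <= m)%N ->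
  pi <= m%:R * tan ((pi : R) / m%:R) <= pi / cos (pi / m%:R).
Proof.
move=> m3; have c0 := cos_pi_div_gt0 R m m3.
have /andP[lo hi] := mul_sin_pi_div_bounds R m m3.
by rewrite /tan mulrA ler_pdivlMr// lo ler_pM2r ?invr_gt0.
Qed.

Lemma supremums_inscribed (R : realType) (k : nat) : (3 <= k)%N ->
  supremums [set (2 ^ n * k)%:R * sin (pi / (2 ^ n * k)%:R) | n in [set: nat]]
    (pi : R).
Proof.
move=> k3.
have m3 n : (3 <= 2 ^ n * k)%N by rewrite (leq_trans k3)// leq_pmull// expn_gt0.
have bnd n := mul_sin_pi_div_bounds R _ (m3 n).
apply: supremums_cvg => [n|]; first by have /andP[] := bnd n.
apply: (@squeeze_cvgr _ _ _ _ (fun n => pi * cos (pi / (2 ^ n * k)%:R)) (fun=> pi)).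
- exact: nearW.
- rewrite -[X in _ --> X](mulr1 pi).
  by apply: cvgM; [exact: cvg_cst|apply: cvg_cos_pi_div; lia].
- exact: cvg_cst.
Qed.

Lemma infimums_circumscribed (R : realType) (k : nat) : (3 <= k)%N ->
  infimums [set (2 ^ n * k)%:R * tan (pi / (2 ^ n * k)%:R) | n in [set: nat]]
    (pi : R).
Proof.
move=> k3.
have m3 n : (3 <= 2 ^ n * k)%N by rewrite (leq_trans k3)// leq_pmull// expn_gt0.
have bnd n := mul_tan_pi_div_bounds R _ (m3 n).
apply: infimums_cvg => [n|]; first by have /andP[] := bnd n.
apply: (@squeeze_cvgr _ _ _ _ (fun=> pi) (fun n => pi / cos (pi / (2 ^ n * k)%:R))).
- exact: nearW.
- exact: cvg_cst.
- rewrite -[X in _ --> X](mulr1 pi) -[X in pi * X]invr1.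
  apply: cvgM; first exact: cvg_cst.
  by apply: cvgV; [exact: oner_neq0|apply: cvg_cos_pi_div; lia].
Qed.

(** * Assembly of area and perimeters *)

Theorem theorem1 (R : realType) (k : nat) (hk : (3 <= k)%N) :
  exists C : R, forall (c : R * R) (r : R), 0 < r ->
    [/\ area (disc c r) \is a fin_num,
        fine (area (disc c r)) / r ^+ 2 = C &
        forall v w : forall n : nat, 'I_(2 ^ n * k)%N -> R * R,
          (forall n : nat, regular_polygon (v n) /\ inscribed c r (v n)) ->
          (forall n : nat, circumscribed c (v n) (w n)) ->
          supremums [set perimeter (v n) / (2 * r) | n in [set: nat]] C /\
          infimums [set perimeter (w n) / (2 * r) | n in [set: nat]] C].
Proof.
exists pi => c r r0; rewrite area_disc//; split => //=.
  by rewrite mulfK// expf_neq0// gt_eqF.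
move=> v w vP wP.
have m3 n : (3 <= 2 ^ n * k)%N by rewrite (leq_trans hk)// leq_pmull// expn_gt0.
(* Here [s] stands for the sine or the tangent of [pi / m]; dividing by [2 * r] removes the
   radius. *)
have perE n (u : 'I_(2 ^ n * k) -> R * R) (s : R) :
    (forall i, Defs.edist (u i) (u (ordS i)) = 2 * r * s) ->
    perimeter u / (2 * r) = (2 ^ n * k)%:R * s.
  move=> us; rewrite /perimeter (eq_bigr _ (fun i _ => us i)) sumr_const card_ord.
  by rewrite -mulr_natl; field; lra.
split.
- rewrite (_ : [set _ | n in _] =
      [set (2 ^ n * k)%:R * sin (pi / (2 ^ n * k)%:R) | n in [set: nat]]).
    exact: supremums_inscribed.
  apply: eq_imagel => n _; apply: perE => i.
  by have [vreg vc] := vP n; exact: regular_inscribed_side vreg vc i.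
- rewrite (_ : [set _ | n in _] =
      [set (2 ^ n * k)%:R * tan (pi / (2 ^ n * k)%:R) | n in [set: nat]]).
    exact: infimums_circumscribed.
  apply: eq_imagel => n _; apply: perE => i.
  by have [vreg vc] := vP n; exact: circumscribed_side vreg vc (w n) i (wP n).
Qed.
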